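(* Let $f \colon \mathbb{N} \setminus \{0\} \to \mathbb{N} \setminus \{0\}$ be a function which has a finite-fold Diophantine representation. Then there exists a positive integer $m$ such that $f(n)<\theta(n)$ for every integer $n>m$.
   Context: $\mathbb{N}$ denotes the set of non-negative integers. A set $\mathcal{M} \subseteq \mathbb{N}^k$ has a finite-fold Diophantine representation if there is a polynomial $W(a_1,\ldots,a_k,x_1,\ldots,x_r)$ with integer coefficients such that for all $(a_1,\ldots,a_k)\in\mathbb{N}^k$: $(a_1,\ldots,a_k)\in\mathcal{M}$ iff there exist $x_1,\ldots,x_r \in \mathbb{N}$ with $W(a_1,\ldots,a_k,x_1,\ldots,x_r)=0$, and moreover for every $(a_1,\ldots,a_k)\in\mathbb{N}^k$ the equation $W(a_1,\ldots,a_k,x_1,\ldots,x_r)=0$ has only finitely many solutions $(x_1,\ldots,x_r)\in\mathbb{N}^r$. A function $f$ is said to have a finite-fold Diophantine representation if its graph $\{(n,f(n))\} \subseteq \mathbb{N}^2$ does. For a positive integer $n$, let $E_n=\{x_i \cdot x_j=x_k,\ x_i+1=x_k:\ i,j,k \in \{1,\ldots,n\}\}$, and let $\theta(n)$ denote the smallest positive integer $b$ such that for each system $S \subseteq E_n$ which has a solution in positive integers $x_1,\ldots,x_n$ and which has only finitely many solutions in positive integers $x_1,\ldots,x_n$, there exists a solution of $S$ in $([1,b] \cap \mathbb{N})^n$. *)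

(* Defs.v *)
From mathcomp Require Import all_boot all_order all_algebra.
From mathcomp Require Import boolp classical_sets cardinality.
From mathcomp Require Import mpoly.

Set Implicit Arguments.
Unset Strict Implicit.
Unset Printing Implicit Defensive.

Local Open Scope classical_set_scope.
Local Open Scope nat_scope.

(* The first k variables of W are the parameters a, the last r the unknowns x. *)
Definition eval_nat (k r : nat) (W : {mpoly int[k + r]})
    (a : k.-tuple nat) (x : r.-tuple nat) : int :=
  W.@[fun i => Posz (tnth (cat_tuple a x) i)]%R.

Definition nat_zeros (k r : nat) (W : {mpoly int[k + r]}) (a : k.-tuple nat) :
    set (r.-tuple nat) :=
  [set x : r.-tuple nat | eval_nat W a x = 0%R].

Definition finite_fold_diophantine (k : nat) (M : set (k.-tuple nat)) : Prop :=
  exists (r : nat) (W : {mpoly int[k + r]}),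
    (forall a : k.-tuple nat, M a <-> exists x : r.-tuple nat, nat_zeros W a x) /\
    (forall a : k.-tuple nat, finite_set (nat_zeros W a)).

(* A function on the positive integers is given by a total f : nat -> nat whose
   value at 0 is ignored. *)
Definition pos_graph (f : nat -> nat) : set (2.-tuple nat) :=
  [set [tuple n; f n] | n in [set n : nat | 0 < n]].

(* The elements of E_n: inl (i, j, k) is the equation x_i * x_j = x_k and
   inr (i, k) is the equation x_i + 1 = x_k. *)
Definition equation (n : nat) : finType :=
  ('I_n * 'I_n * 'I_n + 'I_n * 'I_n)%type.

Definition satisfies (n : nat) (x : n.-tuple nat) (e : equation n) : Prop :=
  match e with
  | inl (i, j, k) => tnth x i * tnth x j = tnth x k
  | inr (i, k) => tnth x i + 1 = tnth x k
  end.

Definition pos_solutions (n : nat) (S : {set equation n}) : set (n.-tuple nat) :=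
  [set x : n.-tuple nat | (forall i : 'I_n, 0 < tnth x i) /\
                          (forall e : equation n, e \in S -> satisfies x e)].

Definition theta_bound (n b : nat) : Prop :=
  forall S : {set equation n},
    (exists x : n.-tuple nat, pos_solutions S x) ->
    finite_set (pos_solutions S) ->
    exists2 x : n.-tuple nat,
      pos_solutions S x & forall i : 'I_n, 1 <= tnth x i <= b.

Lemma theta_bound_ex (n : nat) : exists b : nat, (0 < b) && `[< theta_bound n b >].
Proof.
have /choice [B BP] : forall S : {set equation n}, exists b : nat,
    (exists x, pos_solutions S x) ->
    exists2 x, pos_solutions S x & forall i, 1 <= tnth x i <= b.
  move=> S; have [[x Sx]|nS] := pselect (exists x, pos_solutions S x); last first.
    by exists 0.
  exists (\max_i tnth x i) => _; exists x => // i.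
  by rewrite (leq_bigmax (F := fun i => tnth x i)) (proj1 Sx).
exists (\max_S B S).+1; apply/asboolP => S /BP [x Sx xB] _.
exists x => // i; have /andP [-> le_xB] := xB i.
by rewrite (leq_trans le_xB) // leqW // (leq_bigmax (F := B)).
Qed.

Definition theta (n : nat) : nat := ex_minn (theta_bound_ex n).

(* Main.v *)
(* Let W be a finite-fold representation of the graph of f. Substituting
   x_i = X_i - 1 with X_i positive, W = P - Q for terms P, Q built from 1, + and *
   only. Evaluating such a term by equations of E_n introduces auxiliary variables
   that are uniquely determined by the X_i, because for positive integers
     x + y = z  <->  (z x + 1) (z y + 1) = z^2 (x y + 1) + 1.
   The number of variables used for P = Q is a constant; fixing X_0 = n + 1 costs
   about n / 2 more, and the remaining variables are set to 1. For large n this is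
   a system in exactly n variables whose solutions correspond to those of
   W(n, f(n), x) = 0, so there are finitely many, at least one, and each has
   X_1 = f(n) + 1 as a coordinate. *)

Require Import Defs.
From mathcomp Require Import all_boot all_order all_algebra.
From mathcomp Require Import boolp classical_sets cardinality mpoly.
From mathcomp Require Import zify ring.

Set Implicit Arguments.
Unset Strict Implicit.
Unset Printing Implicit Defensive.

Import GRing.Theory.
Local Open Scope nat_scope.

(** * Integer polynomials as differences of positive terms *)

Inductive term : Type :=
  | Var of nat
  | One
  | Add of term & term
  | Mul of term & term.

Fixpoint eval (v : nat -> nat) (t : term) : nat :=
  match t with
  | Var i => v i
  | One => 1
  | Add s t => eval v s + eval v t
  | Mul s t => eval v s * eval v t
  end.

Fixpoint vars_below (m : nat) (t : term) : bool :=
  match t with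
  | Var i => i < m
  | One => true
  | Add s t => vars_below m s && vars_below m t
  | Mul s t => vars_below m s && vars_below m t
  end.

Definition positive (v : nat -> nat) : Prop := forall i, 0 < v i.

Definition agree (c : nat) (v w : nat -> nat) : Prop :=
  forall i, i < c -> v i = w i.

Lemma vars_below_leq m n t : m <= n -> vars_below m t -> vars_below n t.
Proof.
move=> le_mn; elim: t => //= [i /leq_trans -> //|s IHs t IHt|s IHs t IHt];
  by move=> /andP[/IHs -> /IHt ->].
Qed.

(* The shift by 1 turns the unknowns, which range over the non-negative
   integers, into variables ranging over the positive ones. *)
Definition term_difference (m : nat) (W : {mpoly int[m]}) : Prop :=
  exists P Q : term, [/\ vars_below m P, vars_below m Q &
    forall v, positive v ->
      (W.@[fun i => Posz (v i).-1] = (eval v P)%:Z - (eval v Q)%:Z)%R].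

Lemma term_differenceD m (U W : {mpoly int[m]}) :
  term_difference U -> term_difference W -> term_difference (U + W)%R.
Proof.
move=> [P [Q [bP bQ PQ]]] [P' [Q' [bP' bQ' PQ']]].
exists (Add P P'), (Add Q Q'); split; rewrite /= ?bP ?bQ // => v v_gt0.
by rewrite mevalD PQ // PQ' // !PoszD; ring.
Qed.

Lemma term_differenceM m (U W : {mpoly int[m]}) :
  term_difference U -> term_difference W -> term_difference (U * W)%R.
Proof.
move=> [P [Q [bP bQ PQ]]] [P' [Q' [bP' bQ' PQ']]].
exists (Add (Mul P P') (Mul Q Q')), (Add (Mul P Q') (Mul Q P')).
split; rewrite /= ?bP ?bQ ?bP' ?bQ' // => v v_gt0.
by rewrite mevalM PQ // PQ' // !PoszD !PoszM; ring.
Qed.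

Lemma term_differenceN m (W : {mpoly int[m]}) :
  term_difference W -> term_difference (- W)%R.
Proof.
move=> [P [Q [bP bQ PQ]]]; exists Q, P; split=> // v v_gt0.
by rewrite mevalN PQ // opprB.
Qed.

Lemma term_difference1 m : term_difference (1 : {mpoly int[m]})%R.
Proof.
(* Every term is positive at a positive valuation, so even 1 has to be written as 2 - 1. *)
exists (Add One One), One; split=> // v _.
by rewrite meval1.
Qed.

Lemma term_difference0 m : term_difference (0 : {mpoly int[m]})%R.
Proof. by exists One, One; split=> // v _; rewrite meval0 subrr. Qed.

Lemma term_differenceU m (i : 'I_m) : term_difference ('X_i : {mpoly int[m]})%R.
Proof.
exists (Var i), One; split=> //= v v_gt0.
by rewrite mevalXU; have := v_gt0 i; lia.
Qed.

Lemma term_differenceMn m (W : {mpoly int[m]}) k :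
  term_difference W -> term_difference (W *+ k)%R.
Proof.
move=> dW; elim: k => [|k IHk]; first exact: term_difference0.
by rewrite mulrS; apply: term_differenceD.
Qed.

Lemma term_differenceX m (W : {mpoly int[m]}) k :
  term_difference W -> term_difference (W ^+ k)%R.
Proof.
move=> dW; elim: k => [|k IHk]; first exact: term_difference1.
by rewrite exprS; apply: term_differenceM.
Qed.

(** Expands [W] into monomials; each integer coefficient is a repeated sum of 1, negated if
    needed. *)
Lemma term_differenceP m (W : {mpoly int[m]}) : term_difference W.
Proof.
rewrite [W]mpolyE; apply: big_ind => [||d _].
- exact: term_difference0.
- by move=> U V; apply: term_differenceD.
rewrite -mul_mpolyC; apply: term_differenceM; last first.
  rewrite mpolyXE_id; apply: big_ind => [||i _].
  - exact: term_difference1.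
  - by move=> U V; apply: term_differenceM.
  - exact/term_differenceX/term_differenceU.
case: (W@_d)%R => k.
  by rewrite -[Posz k]natz rmorph_nat; exact/term_differenceMn/term_difference1.
rewrite NegzE -[Posz k.+1]natz rmorphN rmorph_nat.
exact/term_differenceN/term_differenceMn/term_difference1.
Qed.

(** * Systems over variables indexed by [nat] *)

(* Same encoding as [equation], with variables indexed by all of [nat]. *)
Definition nat_equation : eqType := (nat * nat * nat + nat * nat)%type.

Definition holds (v : nat -> nat) (e : nat_equation) : Prop :=
  match e with
  | inl (i, j, k) => v i * v j = v k
  | inr (i, k) => v i + 1 = v k
  end.

Definition equation_below (c : nat) (e : nat_equation) : bool :=
  match e with
  | inl (i, j, k) => [&& i < c, j < c & k < c]
  | inr (i, k) => (i < c) && (k < c)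
  end.

Definition sat (v : nat -> nat) (s : seq nat_equation) : Prop :=
  forall e, e \in s -> holds v e.

Lemma sat_cat v s t : sat v (s ++ t) <-> sat v s /\ sat v t.
Proof.
split=> [sv|[sv tv] e]; last by rewrite mem_cat => /orP[/sv|/tv].
by split=> e es; apply: sv; rewrite mem_cat es ?orbT.
Qed.

Lemma sat_cons v e s : sat v (e :: s) <-> holds v e /\ sat v s.
Proof.
split=> [sv|[ve sv] e']; last by rewrite inE => /predU1P[->|/sv].
by split=> [|e' es]; apply: sv; rewrite inE ?eqxx ?es ?orbT.
Qed.

Lemma sat_nil v : sat v [::].
Proof. by []. Qed.

(** * Systems that determine new variables from old ones *)

Lemma agree_leq c d v w : c <= d -> agree d v w -> agree c v w.
Proof. by move=> le_cd vw i lt_ic; apply: vw; apply: leq_trans le_cd. Qed.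

Lemma agree_trans c u v w : agree c u v -> agree c v w -> agree c u w.
Proof. by move=> uv vw i lt_ic; rewrite uv // vw. Qed.

Lemma agree_sym c v w : agree c v w -> agree c w v.
Proof. by move=> vw i /vw. Qed.

Lemma sat_agree c v w s :
  all (equation_below c) s -> agree c v w -> sat v s -> sat w s.
Proof.
move=> /allP below vw sv e es; have := below e es; have := sv e es.
case: e {es} => [[[i j] k]|[i k]] /= H.
  by move=> /and3P[hi hj hk]; rewrite -!vw.
by move=> /andP[hi hk]; rewrite -!vw.
Qed.

(** The variables from [c] to [d - 1] are auxiliary. Existence keeps the final system solvable;
    uniqueness keeps its solution set finite. *)
Record unique_extension (c d : nat) (s : seq nat_equation) : Prop := {
  ext_leq : c <= d;
  ext_below : all (equation_below d) s;
  ext_exists : forall v, positive v ->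
    exists w, [/\ positive w, agree c v w & sat w s];
  ext_unique : forall v w, positive v -> positive w ->
    sat v s -> sat w s -> agree c v w -> agree d v w }.

Lemma equation_below_leq c d s :
  c <= d -> all (equation_below c) s -> all (equation_below d) s.
Proof.
move=> le_cd; apply: sub_all => -[[[i j] k]|[i k]] /=; lia.
Qed.

Lemma unique_extension_nil c : unique_extension c c [::].
Proof. by split=> // v v_gt0; exists v. Qed.

Lemma unique_extension_cat c d e s t :
  unique_extension c d s -> unique_extension d e t ->
  unique_extension c e (s ++ t).
Proof.
move=> [cd sd exs uns] [de te ext unt]; split.
- exact: leq_trans de.
- by rewrite all_cat (equation_below_leq de sd) te.
- move=> v /exs[w [w_gt0 vw sw]]; have [x [x_gt0 wx tx]] := ext w w_gt0.
  exists x; split=> //; first by apply: agree_trans vw (agree_leq cd wx).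
  (* [s] mentions only variables below [d], which the second extension leaves unchanged. *)
  by apply/sat_cat; split=> //; apply: sat_agree wx sw.
- move=> v w v_gt0 w_gt0 /sat_cat[sv tv] /sat_cat[sw tw] vw.
  by apply: unt => //; apply: uns.
Qed.

Definition update (c x : nat) (v : nat -> nat) : nat -> nat :=
  fun i => if i == c then x else v i.

Lemma update_positive c x v : 0 < x -> positive v -> positive (update c x v).
Proof. by rewrite /update => x_gt0 v_gt0 i; case: eqP. Qed.

Lemma update_agree c x v : agree c v (update c x v).
Proof. by move=> i; rewrite /update; case: eqP => // ->; rewrite ltnn. Qed.

Lemma update_eq c x v : update c x v c = x.
Proof. by rewrite /update eqxx. Qed.

(* [F] computes the value forced on the variable [c] by the variables below it. *)
Lemma unique_extension1 c e (F : (nat -> nat) -> nat) :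
  equation_below c.+1 e ->
  (forall v w, agree c v w -> F v = F w) ->
  (forall v, positive v -> 0 < F v) ->
  (forall v, positive v -> holds v e <-> v c = F v) ->
  unique_extension c c.+1 [:: e].
Proof.
move=> be Fagree F_gt0 eF; split=> //=; first by rewrite be.
- move=> v v_gt0; exists (update c (F v) v).
  have w_gt0 : positive (update c (F v) v) by apply: update_positive; auto.
  split=> //; first exact: update_agree.
  apply/sat_cons; split=> //; apply/eF => //.
  by rewrite update_eq; apply/Fagree/update_agree.
- move=> v w v_gt0 w_gt0 /sat_cons[/eF-/(_ v_gt0) ev _].
  move=> /sat_cons[/eF-/(_ w_gt0) ew _] vw i.
  by rewrite ltnS leq_eqVlt => /predU1P[->|/vw //]; rewrite ev ew; apply: Fagree.
Qed.

(** Among positive integers, x x = x forces x = 1. *)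
Lemma unique_extension_one c : unique_extension c c.+1 [:: inl (c, c, c)].
Proof.
apply: (unique_extension1 (F := fun=> 1)) => //= [|v v_gt0]; first by rewrite ltnSn.
by have := v_gt0 c; nia.
Qed.

Lemma unique_extension_succ c i :
  i < c -> unique_extension c c.+1 [:: inr (i, c)].
Proof.
move=> lt_ic; apply: (unique_extension1 (F := fun v => v i + 1)) => //=.
- lia.
- by move=> v w ->.
- by move=> v; rewrite addn1.
- by move=> v _; split.
Qed.

Lemma unique_extension_mul c i j :
  i < c -> j < c -> unique_extension c c.+1 [:: inl (i, j, c)].
Proof.
move=> lt_ic lt_jc; apply: (unique_extension1 (F := fun v => v i * v j)) => //=.
- lia.
- by move=> v w vw; rewrite !vw.
- by move=> v v_gt0; rewrite muln_gt0 !v_gt0.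
- by move=> v _; split.
Qed.

(** * Addition expressed by multiplication and successor *)

(** With x, y, z at [i], [j], [c], the variables [c + 1] to [c + 9] hold z x, z x + 1, z y, z y + 1,
    (z x + 1)(z y + 1), z^2, x y, x y + 1, z^2 (x y + 1). The last equation closes the identity. *)
Definition addition_system (i j c : nat) : seq nat_equation :=
  [:: inl (c, i, c + 1); inr (c + 1, c + 2);
      inl (c, j, c + 3); inr (c + 3, c + 4); inl (c + 2, c + 4, c + 5);
      inl (c, c, c + 6); inl (i, j, c + 7); inr (c + 7, c + 8);
      inl (c + 6, c + 8, c + 9); inr (c + 9, c + 5)].

(** Both sides contain z^2 x y + 1; cancelling it leaves z (x + y) = z^2. *)
Lemma addition_identity x y z : 0 < z ->
  (z * x + 1) * (z * y + 1) = z * z * (x * y + 1) + 1 <-> z = x + y.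
Proof.
move=> z_gt0.
have -> : (z * x + 1) * (z * y + 1) = z * z * (x * y) + 1 + z * (x + y) by ring.
have -> : z * z * (x * y + 1) + 1 = z * z * (x * y) + 1 + z * z by ring.
split=> [/addnI/eqP|<- //].
by rewrite eqn_pmul2l // => /eqP.
Qed.

Lemma addition_system_eval i j c v : positive v ->
  sat v (addition_system i j c) -> v c = v i + v j.
Proof.
move=> v_gt0 /sat_cons[/= e1] /sat_cons[/= e2] /sat_cons[/= e3] /sat_cons[/= e4].
move=> /sat_cons[/= e5] /sat_cons[/= e6] /sat_cons[/= e7] /sat_cons[/= e8].
move=> /sat_cons[/= e9] /sat_cons[/= e10] _.
apply/addition_identity => //.
by rewrite e1 e2 e3 e4 e5 e6 e7 e8 e9 e10.
Qed.

(** No single equation computes [c] from the variables below it; only the whole system pins it down,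
    so the ten variables are treated together. *)
Lemma unique_extension_add i j c : i < c -> j < c ->
  unique_extension c (c + 10) (addition_system i j c).
Proof.
move=> lt_ic lt_jc; split.
- lia.
- by rewrite /addition_system /=; lia.
- move=> v v_gt0; pose x := v i; pose y := v j; pose z := x + y.
  pose vals := [:: z; z * x; z * x + 1; z * y; z * y + 1;
    (z * x + 1) * (z * y + 1); z * z; x * y; x * y + 1; z * z * (x * y + 1)].
  (* The default 1 keeps [w] positive beyond the ten listed values. *)
  pose w k := if k < c then v k else nth 1 vals (k - c).
  have x_gt0 : 0 < x by apply: v_gt0.
  have y_gt0 : 0 < y by apply: v_gt0.
  have z_gt0 : 0 < z by rewrite addn_gt0 x_gt0.
  have wlow k : k < c -> w k = v k by rewrite /w => ->.
  have whigh k : w (c + k) = nth 1 vals k.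
    by rewrite /w ltnNge leq_addr addKn.
  exists w; split=> [k|k /wlow -> //|].
    rewrite /w; case: ifP => // _.
    have [lt_k|ge_k] := ltnP (k - c) (size vals); last by rewrite nth_default.
    have /all_nthP -> // : all (leq 1) vals.
    by rewrite /= !addn1 /= !muln_gt0 x_gt0 y_gt0 z_gt0.
  have w0 : w c = z by rewrite -[c]addn0 whigh.
  do 9![apply/sat_cons; split;
    first by rewrite /= ?w0 ?whigh ?(wlow _ lt_ic) ?(wlow _ lt_jc)].
  apply/sat_cons; split; last exact: sat_nil.
  by rewrite /= !whigh /=; apply/esym/addition_identity.
- move=> v w v_gt0 w_gt0 sv sw vw.
  (* Once the two valuations agree at [c], the first nine equations compute the other variables in
     order. *)
  have ec : v c = w c.
    by rewrite (addition_system_eval v_gt0 sv) (addition_system_eval w_gt0 sw) !vw.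
  move: sv => /sat_cons[/= e1] /sat_cons[/= e2] /sat_cons[/= e3] /sat_cons[/= e4].
  move=> /sat_cons[/= e5] /sat_cons[/= e6] /sat_cons[/= e7] /sat_cons[/= e8].
  move=> /sat_cons[/= e9] _.
  move: sw => /sat_cons[/= f1] /sat_cons[/= f2] /sat_cons[/= f3] /sat_cons[/= f4].
  move=> /sat_cons[/= f5] /sat_cons[/= f6] /sat_cons[/= f7] /sat_cons[/= f8].
  move=> /sat_cons[/= f9] _.
  have [ei ej] : v i = w i /\ v j = w j by rewrite !vw.
  move=> k lt_k; have [/vw //|le_ck] := ltnP k c.
  rewrite -(subnKC le_ck); have : k - c < 10 by lia.
  have g1 : v (c + 1) = w (c + 1) by rewrite -e1 -f1 ec ei.
  have g2 : v (c + 2) = w (c + 2) by rewrite -e2 -f2 g1.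
  have g3 : v (c + 3) = w (c + 3) by rewrite -e3 -f3 ec ej.
  have g4 : v (c + 4) = w (c + 4) by rewrite -e4 -f4 g3.
  have g5 : v (c + 5) = w (c + 5) by rewrite -e5 -f5 g2 g4.
  have g6 : v (c + 6) = w (c + 6) by rewrite -e6 -f6 ec.
  have g7 : v (c + 7) = w (c + 7) by rewrite -e7 -f7 ei ej.
  have g8 : v (c + 8) = w (c + 8) by rewrite -e8 -f8 g7.
  have g9 : v (c + 9) = w (c + 9) by rewrite -e9 -f9 g6 g8.
  case: (k - c) => [|[|[|[|[|[|[|[|[|[|l]]]]]]]]]] // _; by rewrite ?addn0.
Qed.

(** * Systems for terms, numerals and polynomials *)

(** By structural induction: the second subterm places its auxiliary variables above those of the
    first, so the two extensions compose. *)
Lemma term_system t c : vars_below c t -> exists d s j,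
  [/\ unique_extension c d s, j < d &
      forall v, positive v -> sat v s -> v j = eval v t].
Proof.
elim: t c => /= [i||t1 IH1 t2 IH2|t1 IH1 t2 IH2] c.
- by exists c, [::], i; split=> //; apply: unique_extension_nil.
- move=> _; exists c.+1, [:: inl (c, c, c)], c; split=> //.
    exact: unique_extension_one.
  by move=> v v_gt0 /sat_cons[/= + _]; have := v_gt0 c; nia.
- move=> /andP[b1 b2]; have [d [s [i [ext1 lt_id ev1]]]] := IH1 c b1.
  have le_cd := ext_leq ext1.
  have [e [t [j [ext2 lt_je ev2]]]] := IH2 d (vars_below_leq le_cd b2).
  have lt_ie := leq_trans lt_id (ext_leq ext2).
  exists (e + 10), ((s ++ t) ++ addition_system i j e), e; split.
  + apply: unique_extension_cat; first exact: unique_extension_cat ext2.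
    exact: unique_extension_add.
  + lia.
  + move=> v v_gt0 /sat_cat[/sat_cat[sv tv] av].
    by rewrite (addition_system_eval v_gt0 av) ev1 // ev2.
- move=> /andP[b1 b2]; have [d [s [i [ext1 lt_id ev1]]]] := IH1 c b1.
  have le_cd := ext_leq ext1.
  have [e [t [j [ext2 lt_je ev2]]]] := IH2 d (vars_below_leq le_cd b2).
  have lt_ie := leq_trans lt_id (ext_leq ext2).
  exists e.+1, ((s ++ t) ++ [:: inl (i, j, e)]), e; split=> //.
  + apply: unique_extension_cat; first exact: unique_extension_cat ext2.
    exact: unique_extension_mul.
  + move=> v v_gt0 /sat_cat[/sat_cat[sv tv] /sat_cons[/= <- _]].
    by rewrite ev1 // ev2.
Qed.

Lemma numeral_chain c h : exists s, unique_extension c (c + h.+1) s /\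
  forall v, positive v -> sat v s -> forall k, k <= h -> v (c + k) = k.+1.
Proof.
elim: h => [|h [s [ext_s sP]]].
  exists [:: inl (c, c, c)]; split; first by rewrite addn1; apply: unique_extension_one.
  move=> v v_gt0 /sat_cons[/= + _] k; rewrite leqn0 => + /eqP->; rewrite addn0.
  by have := v_gt0 c; nia.
exists (s ++ [:: inr (c + h, c + h.+1)]); split.
  rewrite [c + h.+2]addnS; apply: unique_extension_cat ext_s _.
  by apply: unique_extension_succ; rewrite ltn_add2l.
move=> v v_gt0 /sat_cat[sv /sat_cons[/= ev _]] k.
rewrite leq_eqVlt ltnS => /predU1P[->|]; last exact: sP.
by rewrite -ev sP // addn1.
Qed.

(** Spare variables are forced to 1, which fills up the variable count without multiplying
    solutions. *)
Lemma padding_system c d : c <= d -> exists s, unique_extension c d s.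
Proof.
move=> /subnKC <-; elim: (d - c) => [|k [s ext_s]].
  by exists [::]; rewrite addn0; apply: unique_extension_nil.
exists (s ++ [:: inl (c + k, c + k, c + k)]); rewrite addnS.
exact/(unique_extension_cat ext_s)/unique_extension_one.
Qed.

(* Half of the [n] variables count up to [n.+1./2]; doubling then reaches [n.+1]
   and leaves room for the fixed number of variables needed by [W]. *)
Lemma polynomial_system m (W : {mpoly int[m]}) : 0 < m ->
  exists C, forall n, C <= n -> exists t u,
  [/\ unique_extension m n t, all (equation_below n) u &
      forall v, positive v -> sat v t ->
        sat v u <-> v 0 = n.+1 /\ W.@[fun i => Posz (v i).-1]%R = 0%R].
Proof.
move=> m_gt0; have [P [Q [bP bQ WPQ]]] := term_differenceP W.
have [d [s [p [ext_s lt_pd evP]]]] := term_system bP.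
have le_md := ext_leq ext_s.
have [e [t [q [ext_t lt_qe evQ]]]] := term_system (vars_below_leq le_md bQ).
have le_de := ext_leq ext_t.
(* This bound gives [h >= e + 2], hence [e + h + 1 <= 2 * h - 1 <= n]: the numerals and their double
   fit. *)
exists (e + e + 4) => n le_n.
pose h := n.+1./2; pose b := odd n.+1.
have nE : b + (h + h) = n.+1 by rewrite addnn odd_double_half.
have b_le1 : b <= 1 by case: (b).
have h_ge2 : 1 < h by lia.
have [a [ext_a aP]] := numeral_chain e h.-1.
rewrite prednK ?(ltnW h_ge2) // in ext_a.
have le_n' : (e + h).+1 <= n by lia.
have [z ext_z] := padding_system le_n'.
(* The numerals 1 to [h] occupy [e] to [e + h.-1]; the added equation multiplies 2 by [h] and stores
   the result at [e + h]. *)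
exists ((((s ++ t) ++ a) ++ [:: inl (e + 1, e + h.-1, e + h)]) ++ z).
(* These equations constrain existing variables. As [e] holds 1, the first says P = Q; the second
   sets variable 0 to 2h + 1 or 2h, according to parity. *)
exists [:: inl (e, p, q);
           if b then inr (e + h, 0) else inl (e, e + h, 0)].
split.
- apply: unique_extension_cat ext_z; apply: unique_extension_cat.
    exact/(unique_extension_cat _ ext_a)/(unique_extension_cat ext_s).
  by apply: unique_extension_mul; lia.
- by rewrite /=; case: (b) => /=; lia.
move=> v v_gt0 /sat_cat[/sat_cat[/sat_cat[/sat_cat[sv tv] av]]].
move=> /sat_cons[/= dv _] _.
have {evP} vp := evP v v_gt0 sv; have {evQ} vq := evQ v v_gt0 tv.
have {}aP := aP v v_gt0 av.
have v1 : v e = 1 by rewrite -[e]addn0 aP.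
have {dv} vh : v (e + h) = h + h by rewrite -dv !aP; lia.
have -> : W.@[fun i => Posz (v i).-1]%R = 0%R <-> v p = v q.
  by rewrite WPQ // -vp -vq; split=> [/eqP|->]; rewrite ?subrr // subr_eq0 => /eqP[].
have -> : v 0 = n.+1 <->
    holds v (if b then inr (e + h, 0) else inl (e, e + h, 0)).
  by rewrite -nE; case: (b) => /=; rewrite ?v1 vh; lia.
rewrite 2!sat_cons /= v1 mul1n; split=> [[-> [? _]] //|[? ->]].
by split=> //; split=> //; apply: sat_nil.
Qed.

(** * Transfer to subsets of E_n and tuples *)

Definition nat_equation_of (n : nat) (e : equation n) : nat_equation :=
  match e with
  | inl (i, j, k) => inl (val i, val j, val k)
  | inr (i, k) => inr (val i, val k)
  end.

(** The default 1 makes positivity of the tuple equivalent to positivity at every index. *)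
Definition env (n : nat) (x : n.-tuple nat) : nat -> nat := nth 1 x.

Definition system (n : nat) (s : seq nat_equation) : {set equation n} :=
  [set e | nat_equation_of e \in s].

Lemma env_tnth n (x : n.-tuple nat) (i : 'I_n) : env x i = tnth x i.
Proof. by rewrite /env -tnth_nth. Qed.

Lemma env_mktuple n (v : nat -> nat) :
  agree n (env [tuple v i | i < n]) v.
Proof.
by move=> i lt_in; rewrite -[i]/(val (Ordinal lt_in)) env_tnth tnth_mktuple.
Qed.

Lemma env_inj n (x y : n.-tuple nat) : agree n (env x) (env y) -> x = y.
Proof. by move=> xy; apply: eq_from_tnth => i; rewrite -!env_tnth xy. Qed.

Lemma env_positive n (x : n.-tuple nat) :
  positive (env x) <-> forall i : 'I_n, 0 < tnth x i.
Proof.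
split=> [x_gt0 i|x_gt0 i]; first by rewrite -env_tnth.
have [lt_in|ge_in] := ltnP i n; first by rewrite -[i]/(val (Ordinal lt_in)) env_tnth.
by rewrite /env nth_default // size_tuple.
Qed.

Lemma holds_env n (x : n.-tuple nat) (e : equation n) :
  holds (env x) (nat_equation_of e) <-> satisfies x e.
Proof. by case: e => [[[i j] k]|[i k]] /=; rewrite !env_tnth. Qed.

Lemma nat_equation_of_surj n (e : nat_equation) :
  equation_below n e -> exists e' : equation n, nat_equation_of e' = e.
Proof.
case: e => [[[i j] k] /and3P[hi hj hk]|[i k] /andP[hi hk]].
  by exists (inl (Ordinal hi, Ordinal hj, Ordinal hk)).
by exists (inr (Ordinal hi, Ordinal hk)).
Qed.

(** [system] drops equations with an index outside the range; the bound on [s] ensures that none is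
    lost. *)
Lemma pos_solutions_system n s (x : n.-tuple nat) : all (equation_below n) s ->
  pos_solutions (system n s) x <-> positive (env x) /\ sat (env x) s.
Proof.
move=> /allP below; rewrite env_positive.
split=> -[x_gt0 sx]; split=> // e es.
  have [e' e'E] := nat_equation_of_surj (below e es).
  by rewrite -e'E; apply/holds_env/sx; rewrite inE e'E.
by apply/holds_env/sx; rewrite inE in es.
Qed.

(** * Finiteness, the lower bound on [theta], and the theorem *)

Lemma finite_set_injective (T U : Type) (A : set T) (B : set U) (g : T -> U) :
  (forall x, A x -> B (g x)) ->
  (forall x y, A x -> A y -> g x = g y -> x = y) ->
  finite_set B -> finite_set A.
Proof.
move=> gAB g_inj finB.
rewrite -(eq_finite_set (inj_card_eq _ : (g @` A)%classic #= A)%card).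
  by apply: sub_finite_set finB => _ [x Ax <-]; apply: gAB.
by move=> x y; rewrite !inE; apply: g_inj.
Qed.

Lemma lt_theta n b (S : {set equation n}) :
  (exists x, pos_solutions S x) -> finite_set (pos_solutions S) ->
  (forall x, pos_solutions S x -> exists i, b < tnth x i) -> b < theta n.
Proof.
move=> exS finS big; rewrite /theta; case: ex_minnP => c /andP[_ /asboolP bound_c] _.
have [x Sx x_le] := bound_c S exS finS; have [i lt_bi] := big x Sx.
by apply: leq_trans lt_bi _; case/andP: (x_le i).
Qed.

Definition shifted (k : nat) (x : k.-tuple nat) : nat -> nat := fun i => (env x i).+1.

Theorem theorem5 (f : nat -> nat)
    (f_pos : forall n : nat, 0 < n -> 0 < f n)
    (f_dioph : finite_fold_diophantine (pos_graph f)) :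
  exists2 m : nat, 0 < m & forall n : nat, m < n -> f n < theta n.
Proof.
have [r [W [WP finW]]] := f_dioph.
have [C sysC] := polynomial_system W (isT : 0 < 2 + r).
exists C.+1 => // n lt_Cn.
have [t [u [ext_t below_u uP]]] := sysC n (ltnW (ltnW lt_Cn)).
have below_tu : all (equation_below n) (t ++ u) by rewrite all_cat (ext_below ext_t).
have lt_1n : 1 < n by have := ext_leq ext_t; lia.
pose S := system n (t ++ u).
(* Variables 0 and 1 carry the argument and the value of [f]; the unknowns of [W] start at 2. *)
pose unknowns (x : n.-tuple nat) := [tuple (env x (2 + i)).-1 | i < r].
have eval_natE v a b (y : r.-tuple nat) :
    v 0 = a.+1 -> v 1 = b.+1 -> (forall i : 'I_r, v (2 + i) = (tnth y i).+1) ->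
    W.@[fun i => Posz (v i).-1]%R = eval_nat W [tuple a; b] y.
  move=> v0 v1 vy; apply: meval_eq => i; congr Posz.
  rewrite (tnth_nth 0) /=; case: i => -[|[|i]] lt_i /=; rewrite ?v0 ?v1 //.
  by have := vy (Ordinal (lt_i : i < r)); rewrite (tnth_nth 0) /= => ->.
have solP x : pos_solutions S x ->
    [/\ env x 0 = n.+1, env x 1 = (f n).+1 & nat_zeros W [tuple n; f n] (unknowns x)].
  move=> /(pos_solutions_system _ below_tu)[x_gt0 /sat_cat[tx ux]].
  have [x0 Wx] := (uP _ x_gt0 tx).1 ux.
  have zx : nat_zeros W [tuple n; (env x 1).-1] (unknowns x).
    rewrite /nat_zeros /= -(eval_natE (env x)) ?prednK // => i.
    by rewrite tnth_mktuple prednK.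
  (* The zero puts the pair in the graph of [f], so its second entry can only be [f n]. *)
  have [k _ [kn fk]] := (WP _).2 (ex_intro _ _ zx).
  have fE : f n = (env x 1).-1 by rewrite -fk -kn.
  by split=> //; rewrite fE ?prednK.
apply: (@lt_theta _ _ S).
- have [y zy] : exists y, nat_zeros W [tuple n; f n] y.
    by apply/WP; exists n => //=; lia.
  pose v := shifted (cat_tuple [tuple n; f n] y).
  have vE i : v (2 + i) = (nth 1 y i).+1 by [].
  (* [t] extends the shifted zero to all auxiliary variables; [u] then holds because [W] vanishes
     there. *)
  have [w [w_gt0 vw tw]] := ext_exists ext_t (v := v) (fun=> isT).
  have uw : sat w u.
    apply/uP => //; rewrite -vw //; split=> //.
    rewrite (eval_natE _ n (f n) y) -?vw // => i.
    by rewrite -vw ?ltn_add2l // vE -tnth_nth.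
  exists [tuple w i | i < n]; apply/pos_solutions_system => //; split.
    by apply/env_positive => i; rewrite tnth_mktuple.
  apply: (sat_agree below_tu (agree_sym (env_mktuple w))).
  exact/sat_cat.
(* A solution is recovered from its unknowns: variables 0 and 1 are fixed, and [t] determines the
   rest. *)
- apply: (finite_set_injective (g := unknowns)) (finW [tuple n; f n]).
    by move=> x /solP[].
  move=> x y Sx Sy; have [x0 x1 _] := solP x Sx; have [y0 y1 _] := solP y Sy.
  move: Sx Sy => /(pos_solutions_system _ below_tu)[x_gt0 /sat_cat[tx _]].
  move=> /(pos_solutions_system _ below_tu)[y_gt0 /sat_cat[ty _]] eq_xy.
  apply/env_inj/(ext_unique ext_t) => //.
  move=> [|[|i]] lt_i; rewrite ?x0 ?x1 //.
  have := congr1 (fun z => tnth z (Ordinal (lt_i : i < r))) eq_xy.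
  rewrite !tnth_mktuple /= => /(congr1 succn).
  by rewrite !prednK.
- move=> x /solP[_ x1 _]; exists (Ordinal lt_1n).
  by rewrite -env_tnth x1.
Qed.
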